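(* Let $\Lambda$ be a countable group, $H,K$ subgroups of $\Lambda$, $\phi:H\to K$ an isomorphism, and let $\Gamma=HNN(\Lambda,H,K,\phi)$. Assume that $H\neq\Lambda$ or $K\neq\Lambda$. If every finite conjugacy class of $\Lambda$ that is contained in $(H\cap K)^*$ contains an element which is not a fixed point of any of the homomorphisms $\phi^j$ ($j\geqslant 1$), then $\Gamma$ is ICC. In particular, if at least one of the groups $\Lambda$, $H$, $K$, $H\cap K$ is ICC, or if none of the homomorphisms $\phi^j$ ($j\geqslant 1$) has a non-trivial fixed point, then $\Gamma$ is ICC.
   Context: For a group $G$, $G^*=G\setminus\{1\}$. A group $G$ is ICC (has infinite conjugacy classes) if it is infinite and for every $x\in G^*$ the set $\{gxg^{-1}:g\in G\}$ is infinite. The HNN extension is $HNN(\Lambda,H,K,\phi)=\langle \Lambda,t\mid t^{-1}ht=\phi(h)\ \forall h\in H\rangle$, where $H,K\leq\Lambda$ and $\phi:H\to K$ is an isomorphism. The partial iterates $\phi^j$ ($j\geqslant1$) are defined recursively: $\phi^1=\phi$ with domain $\operatorname{Dom}(\phi^1)=H$; for $j\geqslant 2$, $\operatorname{Dom}(\phi^j)=\phi^{-1}(\operatorname{Dom}(\phi^{j-1})\cap K)\subseteq H$ and $\phi^j(h)=\phi(\phi^{j-1}(h))$ for $h\in\operatorname{Dom}(\phi^j)$. By convention, an element outside $\operatorname{Dom}(\phi^j)$ is not a fixed point of $\phi^j$; a fixed point is non-trivial if it is different from $1$. *)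

(* Defs.v *)
From HB Require Import structures.
From mathcomp Require Import all_boot.
From mathcomp Require Import boolp classical_sets functions cardinality.

Set Implicit Arguments.
Unset Strict Implicit.
Unset Printing Implicit Defensive.

Local Open Scope group_scope.
Local Open Scope classical_set_scope.
Local Open Scope quotient_scope.

(* For a subgroup A and x in A, this is the conjugacy class of x in the group
   A; for A = setT it is the usual conjugacy class. *)
Definition conj_class (G : groupType) (A : set G) (x : G) : set G :=
  [set g * x * g^-1 | g in A].

(* [ICC A]: the subgroup A, as a group in its own right, is ICC.  A group G
   itself is ICC when [ICC [set: G]]. *)
Definition ICC (G : groupType) (A : set G) : Prop :=
  infinite_set A /\
  forall x : G, A x -> x <> 1 -> infinite_set (conj_class A x).

(* An isomorphism phi : H -> K between subgroups of L is represented by a total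
   function L -> L of which only the values on H matter. *)
Definition subgroup_iso (L : groupType) (H K : {pred L}) (phi : L -> L) : Prop :=
  set_bij [set` H] [set` K] phi /\ {in H &, {morph phi : x y / x * y}}.

(* Dom(phi^j); only j >= 1 is meaningful. *)
Fixpoint iter_dom (L : groupType) (H K : {pred L}) (phi : L -> L) (j : nat) :
    set L :=
  match j with
  | 0 => setT
  | 1 => [set` H]
  | i.+1 => [set` H] `&` phi @^-1` (iter_dom H K phi i `&` [set` K])
  end.

Definition iter_fixed_point (L : groupType) (H K : {pred L}) (phi : L -> L)
    (j : nat) (x : L) : Prop :=
  iter_dom H K phi j x /\ iter j phi x = x.

(* The HNN extension < L, t | t^-1 h t = phi h, h in H >, as the quotient of
   the words over L + {t, t^-1} by the congruence generated by the relations
   below: inr true is the letter t and inr false the letter t^-1.  The subgroup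
   K = phi(H) does not occur in the presentation. *)
Section HNN.
Variables (L : groupType) (H : {pred L}) (phi : L -> L).

Notation word := (seq (L + bool)).

Inductive hnn_relator : word -> word -> Prop :=
| hnn_one : hnn_relator [:: inl 1] [::]
| hnn_mul x y : hnn_relator [:: inl x; inl y] [:: inl (x * y)]
| hnn_stable b : hnn_relator [:: inr b; inr (~~ b)] [::]
| hnn_conj h : h \in H ->
    hnn_relator [:: inr false; inl h; inr true] [:: inl (phi h)].

Inductive hnn_cong : word -> word -> Prop :=
| hnn_step u v r s : hnn_relator r s -> hnn_cong (u ++ r ++ v) (u ++ s ++ v)
| hnn_refl u : hnn_cong u u
| hnn_sym u v : hnn_cong u v -> hnn_cong v u
| hnn_trans u v w : hnn_cong u v -> hnn_cong v w -> hnn_cong u w.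

Definition hnn_congb : rel word := fun u v => `[< hnn_cong u v >].

Lemma hnn_congb_refl : reflexive hnn_congb.
Proof. by move=> u; apply/asboolP/hnn_refl. Qed.

Lemma hnn_congb_sym : symmetric hnn_congb.
Proof. by move=> u v; apply/asboolP/asboolP => /hnn_sym. Qed.

Lemma hnn_congb_trans : transitive hnn_congb.
Proof.
by move=> v u w /asboolP uv /asboolP vw; apply/asboolP/(hnn_trans uv vw).
Qed.

Canonical hnn_equiv :=
  EquivRel hnn_congb hnn_congb_refl hnn_congb_sym hnn_congb_trans.

Definition HNN := {eq_quot hnn_equiv}.
HB.instance Definition _ := Choice.on HNN.
HB.instance Definition _ := EqQuotient.on HNN.

Lemma hnn_eqP u v : \pi_HNN u = \pi_HNN v <-> hnn_cong u v.
Proof. by split=> [/eqmodP/asboolP|uv]; last apply/eqmodP/asboolP. Qed.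

Lemma hnn_cong_cat u u' v v' :
  hnn_cong u u' -> hnn_cong v v' -> hnn_cong (u ++ v) (u' ++ v').
Proof.
move=> uu' vv'; apply: (@hnn_trans _ (u' ++ v)).
  elim: uu' => {u u'} [a b r s rs|a|a b _|a b c _ ab _].
  - by rewrite -!catA; apply: hnn_step.
  - exact: hnn_refl.
  - exact: hnn_sym.
  - exact: hnn_trans.
elim: vv' => {v v'} [a b r s rs|a|a b _|a b c _ ab _].
- by rewrite !(catA u'); apply: hnn_step.
- exact: hnn_refl.
- exact: hnn_sym.
- exact: hnn_trans.
Qed.

Definition letter_inv (a : L + bool) : L + bool :=
  match a with inl x => inl x^-1 | inr b => inr (~~ b) end.

Definition word_inv (w : word) : word := rev (map letter_inv w).

Lemma letter_invK : involutive letter_inv.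
Proof. by case=> [x|b] /=; rewrite ?invgK ?negbK. Qed.

Lemma word_invK : involutive word_inv.
Proof.
by move=> w; rewrite /word_inv map_rev revK -map_comp map_id_in // => a _ /=;
  exact: letter_invK.
Qed.

Lemma hnn_cong_letterV a : hnn_cong [:: a; letter_inv a] [::].
Proof.
case: a => [x|b] /=; last exact: (hnn_step [::] [::] (hnn_stable b)).
apply: hnn_trans (hnn_step [::] [::] hnn_one).
by have /= := hnn_step [::] [::] (hnn_mul x x^-1); rewrite mulgV.
Qed.

Lemma hnn_cong_wordV w : hnn_cong (w ++ word_inv w) [::].
Proof.
elim: w => [|a w IHw]; first exact: hnn_refl.
rewrite /word_inv /= rev_cons -cats1 -/(word_inv w) catA.
apply: hnn_trans (hnn_cong_letterV a).
apply: (@hnn_cong_cat [:: a] [:: a] _ [:: letter_inv a]); first exact: hnn_refl.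
by apply: (@hnn_cong_cat _ [::]); [exact: IHw|exact: hnn_refl].
Qed.

Lemma hnn_cong_Vword w : hnn_cong (word_inv w ++ w) [::].
Proof. by have := hnn_cong_wordV (word_inv w); rewrite word_invK. Qed.

Lemma hnn_cong_inv u v : hnn_cong u v -> hnn_cong (word_inv u) (word_inv v).
Proof.
move=> uv; apply: (@hnn_trans _ (word_inv u ++ v ++ word_inv v)).
  rewrite -[X in hnn_cong X]cats0; apply: hnn_cong_cat; first exact: hnn_refl.
  exact/hnn_sym/hnn_cong_wordV.
rewrite catA -[X in hnn_cong _ X]cat0s.
apply: hnn_cong_cat; last exact: hnn_refl.
apply: hnn_trans (hnn_cong_Vword u).
by apply: hnn_cong_cat; [exact: hnn_refl|exact: hnn_sym].
Qed.

Definition hnn_mulg (a b : HNN) : HNN := \pi_HNN (repr a ++ repr b).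
Definition hnn_invg (a : HNN) : HNN := \pi_HNN (word_inv (repr a)).

Lemma hnn_repr_pi w : hnn_cong (repr (\pi_HNN w)) w.
Proof. by apply/hnn_eqP; rewrite reprK. Qed.

Lemma hnn_mul_pi u v : hnn_mulg (\pi_HNN u) (\pi_HNN v) = \pi_HNN (u ++ v).
Proof. by apply/hnn_eqP/hnn_cong_cat; apply: hnn_repr_pi. Qed.

Lemma hnn_inv_pi u : hnn_invg (\pi_HNN u) = \pi_HNN (word_inv u).
Proof. by apply/hnn_eqP/hnn_cong_inv/hnn_repr_pi. Qed.

Lemma hnn_piP (a : HNN) : {u : word | a = \pi_HNN u}.
Proof. by exists (repr a); rewrite reprK. Qed.

Lemma hnn_mulgA : associative hnn_mulg.
Proof.
move=> a b c; have [u ->] := hnn_piP a; have [v ->] := hnn_piP b.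
by have [w ->] := hnn_piP c; rewrite !hnn_mul_pi catA.
Qed.

Lemma hnn_mul1g : left_id (\pi_HNN [::]) hnn_mulg.
Proof. by move=> a; have [u ->] := hnn_piP a; rewrite hnn_mul_pi. Qed.

Lemma hnn_mulg1 : right_id (\pi_HNN [::]) hnn_mulg.
Proof. by move=> a; have [u ->] := hnn_piP a; rewrite hnn_mul_pi cats0. Qed.

Lemma hnn_mulVg : left_inverse (\pi_HNN [::]) hnn_invg hnn_mulg.
Proof.
move=> a; have [u ->] := hnn_piP a; rewrite hnn_inv_pi hnn_mul_pi.
exact/hnn_eqP/hnn_cong_Vword.
Qed.

Lemma hnn_mulgV : right_inverse (\pi_HNN [::]) hnn_invg hnn_mulg.
Proof.
move=> a; have [u ->] := hnn_piP a; rewrite hnn_inv_pi hnn_mul_pi.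
exact/hnn_eqP/hnn_cong_wordV.
Qed.

HB.instance Definition _ := isGroup.Build HNN
  hnn_mulgA hnn_mul1g hnn_mulg1 hnn_mulVg hnn_mulgV.

Definition hnn_base (x : L) : HNN := \pi_HNN [:: inl x].
Definition hnn_t : HNN := \pi_HNN [:: inr true].

Lemma hnn_baseM : {morph hnn_base : x y / x * y}.
Proof.
move=> x y; apply: esym; rewrite [LHS]hnn_mul_pi.
exact/hnn_eqP/(hnn_step [::] [::] (hnn_mul x y)).
Qed.

Lemma hnn_tV : hnn_t^-1 = \pi_HNN [:: inr false].
Proof. exact: hnn_inv_pi. Qed.

Lemma hnn_baseJ h : h \in H -> hnn_t^-1 * hnn_base h * hnn_t = hnn_base (phi h).
Proof.
move=> Hh; rewrite hnn_tV [_ * hnn_base h]hnn_mul_pi [LHS]hnn_mul_pi.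
exact/hnn_eqP/(hnn_step [::] [::] (hnn_conj Hh)).
Qed.

(* The universal property of the presentation. *)
Lemma hnn_universal (G : groupType) (f : L -> G) (s : G) :
    {morph f : x y / x * y} ->
    {in H, forall h, s^-1 * f h * s = f (phi h)} ->
  exists! F : HNN -> G,
    [/\ {morph F : a b / a * b}, F \o hnn_base = f & F hnn_t = s].
Proof.
move=> fM fJ.
have f1 : f 1 = 1 by apply: (@mulgI _ (f 1)); rewrite -fM !mulg1.
pose ev (a : L + bool) : G :=
  match a with inl x => f x | inr b => if b then s else s^-1 end.
pose evw (w : word) : G := foldr (fun a g => ev a * g) 1 w.
have evw_cat u v : evw (u ++ v) = evw u * evw v.
  by elim: u => [|a u IHu] /=; rewrite ?mul1g // IHu mulgA.
have evw_cong u v : hnn_cong u v -> evw u = evw v.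
  elim=> {u v} [u v r w rw|//|u v _ ->//|u v w _ -> _ -> //].
  rewrite !evw_cat; congr (_ * (_ * _)).
  case: rw => [|x y|[]|h Hh] /=; rewrite ?mulg1 ?mulgV ?mulVg ?fM //.
  by rewrite mulgA fJ.
have evw_pi w : evw (repr (\pi_HNN w)) = evw w by apply/evw_cong/hnn_repr_pi.
exists (fun a => evw (repr a)); split.
  split; last by rewrite evw_pi /= mulg1.
    by move=> a b; rewrite evw_pi evw_cat.
  by apply/funext => x /=; rewrite evw_pi /= mulg1.
move=> F [FM Fb Ft]; apply/funext => a; rewrite -{2}[a]reprK.
have F1 : F 1 = 1 by apply: (@mulgI _ (F 1)); rewrite -FM !mulg1.
elim: (repr a) => [|c w IHw] /=; first by rewrite F1.
rewrite -cat1s -hnn_mul_pi [RHS]FM -IHw; congr (_ * _).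
case: c => [x|[]] /=; [by rewrite -Fb|by rewrite -Ft|].
apply: (@mulgI _ s); rewrite mulgV -{1}Ft -hnn_tV.
by rewrite -FM mulgV F1.
Qed.

End HNN.

(* Main.v *)
Require Import Defs.
From mathcomp Require Import all_boot.
From mathcomp Require Import boolp classical_sets functions cardinality.

Set Implicit Arguments.
Unset Strict Implicit.
Unset Printing Implicit Defensive.

Local Open Scope group_scope.
Local Open Scope classical_set_scope.
Local Open Scope quotient_scope.

(** An element g of the HNN extension G with finite conjugacy class must lie in
    the base group L: the t-length of a reduced word is an invariant of the
    element ([len_reduced], that is, Britton's lemma), and as soon as H or K is
    proper, an element of positive t-length has conjugates of arbitrarily large
    t-length ([conj_grows]).  In Bass-Serre terms: a bounded displacement forces
    g to fix the tree, because every vertex has at least three neighbours and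
    so there is a ray along which the displacement of a non-trivial g grows.

    All conjugates of g have the same finite class, so the whole class of
    g = x is a finite subset D of L.  Since the conjugates of D by t and t^-1
    stay in L, Britton's lemma gives that D is contained in the intersection of
    H and K, and t^-1 y t = phi y shows that phi maps D injectively into itself
    ([finite_class_orbit]).  Hence every element of D is periodic under phi
    ([finite_orbit_fixed]).  If x is not 1, then D contains the L-class of x,
    which is finite and avoids 1; every element of this class is a fixed point
    of some iterate of phi, against the assumption.

    Britton's lemma comes from the action of G on normal forms: reduced words
    whose syllables are chosen coset representatives. *)

(** * The action on normal forms *)

Section BrittonLength.
Variables (L : groupType) (H K : groupClosed L) (phi : L -> L).
Hypothesis phi_iso : subgroup_iso H K phi.

(** The letter stable b, which is t for b = true and t^-1 for b = false, moves
    to the right past the elements of edge b: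
    stable b * x = swap b x * stable b.  Treating both signs at once halves the
    case analyses below. *)
Definition edge (b : bool) : groupClosed L := if b then K else H.

(** phi for t^-1 and its inverse for t. *)
Definition swap (b : bool) (x : L) : L :=
  if b then xget 1 [set h | h \in H /\ phi h = x] else phi x.

Lemma swap_edge b x : x \in edge b -> swap b x \in edge (~~ b).
Proof.
have [[phiK _ phiS] _] := phi_iso.
case: b => /= xE; last exact: phiK.
by have [h Hh <-] := phiS x xE; case: xgetP => [y _ []|/(_ h)[]].
Qed.

Lemma swapK b x : x \in edge b -> swap (~~ b) (swap b x) = x.
Proof.
have [[phiK phiI phiS] _] := phi_iso.
case: b => /= xE.
  by have [h Hh <-] := phiS x xE; case: xgetP => [y _ []|/(_ h)[]].
case: xgetP => [y _ [Hy]|/(_ x)[] //].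
by apply: phiI; rewrite inE.
Qed.

Lemma swapM b : {in edge b &, {morph swap b : x y / x * y}}.
Proof.
have [[_ phiI _] phiM] := phi_iso.
case: b => x y xE yE; last exact: phiM.
have sx := @swap_edge true x xE; have sy := @swap_edge true y yE.
rewrite -[RHS](@swapK false) ?gpredM //; congr swap => /=.
by rewrite phiM // -{1}(@swapK true _ xE) -{1}(@swapK true _ yE).
Qed.

(** The chosen representative of the right coset of x modulo edge b; it depends
    on the coset only, by extensionality of choose ([rep_eq]). *)
Definition rep (b : bool) (x : L) : L := choose (fun y => y / x \in edge b) x.

Lemma rep_edge b x : x / rep b x \in edge b.
Proof.
rewrite gpredFC; apply: (@chooseP _ (fun y => y / x \in edge b) x).
by rewrite mulgV gpred1.
Qed.

Lemma rep_eq b x y : x / y \in edge b -> rep b x = rep b y.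
Proof.
move=> xy; rewrite /rep.
have E : (fun z => z / x \in edge b) =1 (fun z => z / y \in edge b).
  move=> z; have <- : z / x * (x / y) = z / y by rewrite mulgA mulgVK.
  by rewrite /= [RHS]gpredMr.
rewrite (eq_choose E); apply: choose_id => //.
by rewrite mulgV gpred1.
Qed.

Lemma repK b x : rep b (rep b x) = rep b x.
Proof. by apply: rep_eq; rewrite gpredFC rep_edge. Qed.

Lemma rep_mem b x : (rep b x \in edge b) = (x \in edge b).
Proof.
by rewrite -[in RHS](mulgVK (rep b x) x) gpredMl // rep_edge.
Qed.

(** The pair of a and (b1, x1), ..., (bn, xn) stands for the word
    a t^(b1) x1 ... t^(bn) xn. *)
Definition state : Type := (L * seq (bool * L))%type.

(** Consecutive syllables t^b x t^c y do not cancel: either c = b, or x cannot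
    be moved past t^b. *)
Definition nopinch (p q : bool * L) : bool :=
  (q.1 == p.1) || (p.2 \notin edge p.1).

Definition normal (s : state) : bool :=
  sorted nopinch s.2 && all (fun p => rep p.1 p.2 == p.2) s.2.

(** Left multiplication of a t^(b1) x1 ... by t^b.  Split a = k r with r the
    representative and k in edge b; k passes to the left of t^b, which
    is then pushed in front of r.  If a is in edge b and t^(-b) comes next, the
    whole of a passes and the two letters cancel. *)
Definition stable_act (b : bool) (s : state) : state :=
  let push := (swap b (s.1 / rep b s.1), (b, rep b s.1) :: s.2) in
  if s.2 is p :: u then
    if (p.1 == ~~ b) && (s.1 \in edge b) then (swap b s.1 * p.2, u) else push
  else push.

Definition base_act (x : L) (s : state) : state := (x * s.1, s.2).

Lemma base_act_normal x s : normal s -> normal (base_act x s).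
Proof. by []. Qed.

Lemma stable_act_normal b s : normal s -> normal (stable_act b s).
Proof.
case: s => a [|[c r] u]; rewrite /stable_act /normal /= ?repK ?eqxx //.
case: ifP => [_|E] /andP[us].
  by move=> /andP[_ ->]; rewrite (path_sorted us).
case/andP=> E1 E2; rewrite /= E1 E2 repK eqxx us /nopinch /= rep_mem !andbT.
move: E; case: eqP => [->|cb _] /=; first by move->; rewrite orbT.
by move: cb; case: (c); case: (b).
Qed.

(** A push is undone by a cancellation, and conversely: after cancelling
    t^b k t^(-b) r, the letter t^(-b) can only push, since the absence of a
    pinch behind r excludes a second cancellation, and the representative pushed
    is r itself by normality. *)
Lemma stable_actK b s :
  normal s -> stable_act (~~ b) (stable_act b s) = s.
Proof.
have push a u : (stable_act (~~ b) (swap b (a / rep b a), (b, rep b a) :: u)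
    = (a, u)).
  rewrite /stable_act /= negbK eqxx swap_edge ?rep_edge //=.
  by rewrite swapK ?rep_edge // mulgVK.
case: s => a [|[c r] u]; rewrite /normal /=.
  by rewrite {2}/stable_act /= push.
move=> /andP[us /andP[/eqP rr _]].
rewrite {2}/stable_act /=; case: ifP => [/andP[/eqP cb ab]|_]; last exact: push.
subst c; have sa := swap_edge ab.
have rE : rep (~~ b) (swap b a * r) = r by rewrite (@rep_eq _ _ r) ?mulgK.
have pu : (swap (~~ b) (swap b a * r / rep (~~ b) (swap b a * r)),
  (~~ b, rep (~~ b) (swap b a * r)) :: u) = (a, (~~ b, r) :: u).
  by rewrite rE mulgK swapK.
rewrite /stable_act /=; case: u us pu => [|[c q] u] //= /andP[np _] pu.
case: ifP => // /andP[/eqP cb]; rewrite gpredMl // => rb.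
by move: np; rewrite /nopinch /= cb rb orbF; case: (b).
Qed.

(** The relation t^-1 h t = phi h at the level of states. *)
Lemma stable_act_base b h s : h \in edge b ->
  stable_act b (base_act h s) = base_act (swap b h) (stable_act b s).
Proof.
move=> hb; case: s => a u.
have ra : rep b (h * a) = rep b a by rewrite (@rep_eq _ _ a) ?mulgK.
have push : swap b (h * a / rep b a) = swap b h * swap b (a / rep b a).
  by rewrite -mulgA [LHS]swapM ?rep_edge.
case: u => [|[c r] u]; rewrite /stable_act /base_act /= ra push //.
rewrite gpredMl //; case: ifP => [/andP[_ ab]|] //=.
by rewrite swapM // mulgA.
Qed.

Definition letter_act (c : L + bool) : state -> state :=
  match c with inl x => base_act x | inr b => stable_act b end.

Definition word_act (w : seq (L + bool)) (s : state) : state :=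
  foldr letter_act s w.

Lemma word_act_normal w s : normal s -> normal (word_act w s).
Proof.
move=> ns; elim: w => //= -[x|b] w /=; first exact: base_act_normal.
exact: stable_act_normal.
Qed.

(** Soundness of the action for the presentation.  Only normal states are
    concerned, since t^-1 does not undo t on the others. *)
Lemma word_act_cong u v s :
  hnn_cong H phi u v -> normal s -> word_act u s = word_act v s.
Proof.
move=> uv; elim: uv s => {u v} [u v r w rw|//|u v _ IH|u v w _ IH1 _ IH2] s ns.
- rewrite /word_act !foldr_cat -/(word_act v s); congr foldr.
  have := word_act_normal v ns; move: (word_act v s) => {ns}s.
  case: rw => [|x y|b|h Hh] ns /=.
  + by rewrite /base_act mul1g -surjective_pairing.
  + by rewrite /base_act /= mulgA.
  + by rewrite -{1}(negbK b) stable_actK.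
  + by rewrite (@stable_act_base false) // (@stable_actK true).
- by rewrite IH.
- by rewrite IH1 // IH2.
Qed.

(** * Reduced words and Britton's lemma *)

Local Notation G := (HNN H phi).
Local Notation base := (hnn_base H phi).
Local Notation t := (hnn_t H phi).

Definition act (g : G) : state -> state := word_act (repr g).

Lemma act_pi w s : normal s -> act (\pi w) s = word_act w s.
Proof. by move=> ns; apply: word_act_cong => //; apply: hnn_repr_pi. Qed.

Lemma act_normal g s : normal s -> normal (act g s).
Proof. exact: word_act_normal. Qed.

Lemma actM g h s : normal s -> act (g * h) s = act g (act h s).
Proof.
move=> ns; have -> : g * h = \pi_G (repr g ++ repr h) by [].
by rewrite act_pi // /word_act foldr_cat.
Qed.

Lemma act_base x s : normal s -> act (base x) s = base_act x s.
Proof. by move=> ns; rewrite act_pi. Qed.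

Definition stable (b : bool) : G := if b then t else t^-1.

Lemma stableV b : (stable b)^-1 = stable (~~ b).
Proof. by case: b; rewrite /stable /= ?invgK. Qed.

Lemma act_stable b s : normal s -> act (stable b) s = stable_act b s.
Proof.
move=> ns; have -> : stable b = \pi_G [:: inr b].
  by case: b => //=; apply: hnn_tV.
by rewrite act_pi.
Qed.

Lemma base1 : base 1 = 1.
Proof. by apply: (@mulgI _ (base 1)); rewrite -hnn_baseM !mulg1. Qed.

Lemma baseV x : base x^-1 = (base x)^-1.
Proof. by apply: (@mulgI _ (base x)); rewrite -hnn_baseM !mulgV base1. Qed.

Lemma base_inj : injective base.
Proof.
move=> x y /(congr1 (fun g => (act g (1, [::])).1)).
by rewrite !act_base //= !mulg1.
Qed.

Lemma stable_base b x : x \in edge b ->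
  stable b * base x = base (swap b x) * stable b.
Proof.
move=> xE; case: b xE => xE; rewrite /stable.
  have sx := @swap_edge true x xE.
  rewrite -{1}(@swapK true x xE) /= -hnn_baseJ //.
  by rewrite !mulgA mulgV mul1g.
by rewrite /= -(hnn_baseJ phi xE) mulgK.
Qed.

Definition syllables (s : seq (bool * L)) : G :=
  foldr (fun p g => stable p.1 * base p.2 * g) 1 s.

Definition value (s : state) : G := base s.1 * syllables s.2.

Lemma syllables_cat s u : syllables (s ++ u) = syllables s * syllables u.
Proof. by elim: s => [|p s IH] /=; rewrite ?mul1g // IH !mulgA. Qed.

Lemma syllables_nseq n b : syllables (nseq n (b, 1)) = stable b ^+ n.
Proof. by elim: n => [|n IH] //=; rewrite IH base1 mulg1 expgS. Qed.

Lemma value_stable_act b s : value (stable_act b s) = stable b * value s.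
Proof.
have push a u : value (swap b (a / rep b a), (b, rep b a) :: u)
    = stable b * value (a, u).
  rewrite /value /= !mulgA -stable_base ?rep_edge // -!mulgA; congr (_ * _).
  by rewrite mulgA -hnn_baseM mulgVK.
case: s => a [|[c r] u]; rewrite /stable_act /= ?push //.
case: ifP => [/andP[/eqP -> ab]|_]; last exact: push.
by rewrite /value /= hnn_baseM !mulgA stable_base // -(stableV b) mulgK.
Qed.

Lemma value_act w : value (word_act w (1, [::])) = \pi_G w.
Proof.
elim: w => [|c w IH]; first by rewrite /value /= base1 mulg1.
have -> : \pi_G (c :: w) = \pi_G [:: c] * \pi_G w by rewrite -cat1s -hnn_mul_pi.
rewrite -IH; case: c => [x|b] /=; first by rewrite /value /= hnn_baseM !mulgA.
rewrite value_stable_act; congr (_ * _).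
by case: b => //=; rewrite /stable hnn_tV.
Qed.

(** Acting on the trivial state by a word produces a normal form of the element
    that the word represents. *)
Lemma reducedP g : exists a s, sorted nopinch s /\ g = base a * syllables s.
Proof.
have := value_act (repr g); rewrite reprK => <-.
have : normal (word_act (repr g) (1, [::])) by apply: word_act_normal.
by case: word_act => a s /andP[? _]; exists a, s.
Qed.

Definition len (g : G) : nat := size (act g (1, [::])).2.

Lemma len_base x : len (base x) = 0.
Proof. by rewrite /len act_base. Qed.

(** On a reduced word the action never cancels.  The induction records that the
    leading coefficient after acting lies in edge (~~ p.1): multiplication by it
    cannot turn a coefficient outside edge (~~ p.1) into one inside, so the
    absence of a pinch in front of p persists. *)
Lemma act_reduced p s : path nopinch p s ->
  let u := act (syllables (p :: s)) (1, [::]) in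
  unzip1 u.2 = unzip1 (p :: s) /\ u.1 \in edge (~~ p.1).
Proof.
elim: s p => [|q s IH] [b a] /=.
  move=> _; rewrite mulg1 actM // act_base // act_stable //=.
  by rewrite /stable_act /= swap_edge // rep_edge.
move=> /andP[np qs].
have [] := IH q qs; rewrite -[stable q.1 * _ * _]/(syllables (q :: s)).
move: (syllables (q :: s)) => g.
have nu : normal (act g (1, [::])) by apply: act_normal.
rewrite -[stable b * base a * _]mulgA actM // actM // act_base // act_stable //.
case: act nu => c [|[q1 r] u] //= nu [E us] cE.
rewrite /stable_act /base_act /=; case: ifP => [/andP[/eqP qb]|_ /=]; last first.
  by rewrite E us swap_edge // rep_edge.
move: np cE; rewrite -E qb negbK /nopinch /= => np cE.
rewrite gpredMr // => aE.
by move: np; rewrite -E qb aE orbF; case: (b).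
Qed.

Lemma len_reduced a s : sorted nopinch s -> len (base a * syllables s) = size s.
Proof.
have n0 : normal (1, [::]) by [].
case: s => [|p s]; first by rewrite mulg1 len_base.
move=> /act_reduced[]; move: (syllables _) => g /(congr1 size).
by rewrite !size_map => E _; rewrite /len actM // act_base ?act_normal.
Qed.

Definition in_base (g : G) : Prop := exists x, g = base x.

(** Outside edge b the word t^b x t^(-b) is reduced, of length 2. *)
Lemma stable_conj_base b x :
  in_base (stable b * base x * (stable b)^-1) -> x \in edge b.
Proof.
case=> y E; apply: contraT => xb.
have := @len_reduced 1 [:: (b, x); (~~ b, 1)].
rewrite base1 mul1g /= !base1 !mulg1 -stableV E len_base.
by rewrite /nopinch /= xb orbT => /(_ isT).
Qed.

(** * Conjugates of unbounded length *)

(** When s is empty, x itself is the first syllable; hence the default x.1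
    of head. *)
Lemma path_nopinch p x s : path nopinch p (rcons s x) =
  ((head x.1 (unzip1 s) == p.1) || (p.2 \notin edge p.1))
  && sorted nopinch (rcons s x).
Proof. by case: s => [|q s]; rewrite /= /nopinch // andbT. Qed.

Lemma sorted_rcons_sign s b x y :
  sorted nopinch (rcons s (b, x)) -> sorted nopinch (rcons s (b, y)).
Proof. by case: s => // p s; rewrite /= !rcons_path. Qed.

Lemma path_nseq n b x : path nopinch (b, x) (nseq n (b, 1)).
Proof. by elim: n x => //= n IH x; rewrite IH /nopinch /= eqxx. Qed.

(** Write g = a t^(e1) ... t^e x.  Conjugation by t^(-c(n+1)) l^-1 x gives
    t^(-cn) t^(-c) (l^-1 x a) t^(e1) ... t^e l t^c t^(cn),
    which is reduced provided that there is no pinch at the two ends of the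
    conjugated word; an element outside one of the two edge groups leaves room
    to choose the sign c and the coset of l accordingly. *)
Lemma conj_grows g : (exists b z, z \notin edge b) -> ~ in_base g ->
  forall n, exists2 h, conj_class setT g h & (n <= len h)%N.
Proof.
move=> [b [z zb]] gB n.
have [a [s [ss gE]]] := reducedP g.
case/lastP: s ss gE => [|s [e x]] ss gE.
  by case: gB; exists a; rewrite gE mulg1.
(* c and l give an edge at the base vertex different from the two edges that
   start the geodesics to the images of this vertex under g and its inverse,
   after g has been conjugated by x. *)
pose e1 := head e (unzip1 s).
have [c [l lP]] : exists c l,
    ((e1 == ~~ c) || (l^-1 * (x * a) \notin edge (~~ c))) &&
    ((c == e) || (l \notin edge e)).
  have [e1b|e1b] := eqVneq e1 b; have [eb|eb] := eqVneq e b.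
  - by exists (~~ b), z; rewrite negbK e1b eqxx eb zb orbT.
  - by exists (~~ b), 1; rewrite negbK e1b eqxx; move: eb; case: (e); case: (b).
  - by exists b, 1; rewrite eb eqxx; move: e1b; case: e1; case: (b).
  - exists (~~ b), (x * a * z^-1).
    rewrite negbK invgM invgK mulgVK zb orbT /=.
    by move: eb; case: (e); case: (b).
case/andP: lP => l1 l2.
pose m := nseq n (~~ c, 1) ++ (~~ c, l^-1 * (x * a)) ::
  rcons s (e, l) ++ nseq n.+1 (c, 1 : L).
have sm : sorted nopinch m.
  rewrite /m; apply: (@path_sorted _ _ (~~ c, 1)).
  rewrite cat_path path_nseq /=.
  have -> : last (~~ c, 1) (nseq n (~~ c, 1 : L)) = (~~ c, 1) by elim: (n).
  rewrite {1}/nopinch /= eqxx /= cat_path path_nopinch l1 last_rcons /=.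
  by rewrite (sorted_rcons_sign _ ss) /= path_nseq andbT /nopinch.
exists (syllables m); last first.
  have := len_reduced 1 sm; rewrite base1 mul1g => ->.
  by rewrite size_cat size_nseq leq_addr.
exists (stable (~~ c) ^+ n.+1 * base (l^-1 * x)) => //.
rewrite /m syllables_cat /= syllables_cat -cats1 gE -cats1 !syllables_cat.
rewrite -[_ :: nseq n _]/(nseq n.+1 (c, 1)) !syllables_nseq /=.
rewrite invgM -expVgn stableV negbK -baseV invgM invgK !mulg1 !hnn_baseM.
rewrite expgSr !mulgA; congr (_ * _ * _).
by rewrite (baseV x) mulgK.
Qed.

End BrittonLength.

(** * Elements with a finite conjugacy class *)

Section FiniteClasses.
Variables (L : groupType) (H K : groupClosed L) (phi : L -> L).
Hypothesis phi_iso : subgroup_iso H K phi.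
Hypothesis proper : [set` H] <> [set: L] \/ [set` K] <> [set: L].

Local Notation G := (HNN H phi).
Local Notation base := (hnn_base H phi).
Local Notation t := (hnn_t H phi).

Lemma conj_classxx (A : groupType) (x : A) : conj_class setT x x.
Proof. by exists 1 => //; rewrite mul1g invg1 mulg1. Qed.

Lemma conj_class_trans (A : groupType) (x y z : A) :
  conj_class setT x y -> conj_class setT y z -> conj_class setT x z.
Proof.
move=> [g _ <-] [h _ <-]; exists (h * g) => //.
by rewrite invgM !mulgA.
Qed.

Lemma edge_proper : exists b z, z \notin edge H K b.
Proof.
have P (A : groupClosed L) : [set` A] <> [set: L] -> exists z, z \notin A.
  move=> AT; apply: contrapT => /forallNP AA; apply: AT.
  by apply/seteqP; split => // x _; apply: contrapT => /negP /AA.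
by case: proper => /P[z ?]; [exists false, z|exists true, z].
Qed.

Lemma finite_class_in_base (g : G) :
  finite_set (conj_class setT g) -> in_base g.
Proof.
move=> /finite_seqP[s sE]; apply: contrapT => gB.
have [h gh] := conj_grows phi_iso edge_proper gB (\max_(h <- s) len K h).+1.
rewrite ltnNge leq_bigmax_seq //.
by have : [set` s] h by rewrite -sE.
Qed.

Lemma finite_class_orbit (x : L) :
  x <> 1 -> finite_set (conj_class setT (base x)) ->
  [/\ finite_set (base @^-1` conj_class setT (base x)),
      base @^-1` conj_class setT (base x) `<=` ([set` H] `&` [set` K]) `\ 1,
      conj_class setT x `<=` base @^-1` conj_class setT (base x) &
      forall y, conj_class setT (base x) (base y) ->
        conj_class setT (base x) (base (phi y))].
Proof.
move=> x1 fC.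
have class_base g : conj_class setT (base x) g -> in_base g.
  move=> xg; apply: finite_class_in_base; apply: sub_finite_set fC => h.
  exact: conj_class_trans.
have CH y : conj_class setT (base x) (base y) -> forall b, y \in edge H K b.
  move=> xy b; apply: (stable_conj_base phi_iso); apply: class_base.
  by apply: (conj_class_trans xy); exists (stable H phi b).
split.
- by apply: finite_preimage => // y z _ _; apply: (base_inj phi_iso).
- move=> y xy; split.
    by split; [apply: (CH y xy false)|apply: (CH y xy true)].
  move=> y1; case: xy => g _; rewrite y1 base1 => /eqP.
  rewrite divg_eq mul1g -{2}[g]mulg1 => /eqP/mulgI; rewrite -(base1 H phi).
  by move=> /(base_inj phi_iso).
- move=> _ [l _ <-]; exists (base l) => //.
  by rewrite /= !hnn_baseM baseV.
- move=> y xy; apply: (conj_class_trans xy); exists t^-1 => //.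
  by rewrite invgK hnn_baseJ //; exact: (CH y xy false).
Qed.

(** The orbit of y in the finite set D is eventually periodic; as phi is
    injective on H, it is periodic from the start. *)
Lemma finite_orbit_fixed (D : set L) (y : L) :
  finite_set D -> D `<=` [set` H] `&` [set` K] ->
  (forall z, D z -> D (phi z)) -> D y ->
  exists2 j, (0 < j)%N & iter_fixed_point H K phi j y.
Proof.
have [[_ phiI _] _] := phi_iso.
move=> /finite_seqP[s ->] sHK phis ys.
have it n : iter n phi y \in s by elim: n => //= n IH; apply: phis.
have : ~~ uniq (traject phi y (size s).+1).
  apply/negP => /uniq_leq_size; move=> /(_ s); rewrite size_traject ltnn.
  by move=> sub; suff: false by []; apply: sub => _ /trajectP[i _ ->].
rewrite looping_uniq negbK => /trajectP[i ilt E].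
have inj k m : iter k phi y = iter (k + m) phi y -> y = iter m phi y.
  elim: k => //= k IH /phiI E'; apply: IH; apply: E'; rewrite inE.
    by have [] := sHK _ (it k).
  by have [] := sHK _ (it (k + m)%N).
exists (size s - i)%N; first by rewrite subn_gt0.
split; last by apply/esym/(inj i); rewrite subnKC // ltnW.
elim: (size s - i)%N (y) ys => [//|[|n] IH] z zs; first by have [] := sHK z zs.
split; first by have [] := sHK z zs.
by split; [apply: IH; apply: phis|have [] := sHK _ (phis z zs)].
Qed.

(** G is infinite because t, being of length 1, is not in the base group: its
    class is already infinite. *)
Lemma ICC_of_classes :
  (forall x : L, finite_set (conj_class [set: L] x) ->
      conj_class [set: L] x `<=` ([set` H] `&` [set` K]) `\ 1 ->
      exists2 y : L, conj_class [set: L] x y &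
        forall j : nat, (1 <= j)%N -> ~ iter_fixed_point H K phi j y) ->
  ICC [set: G].
Proof.
move=> hyp; split.
  move=> fG; have [x tx] : in_base t by apply/finite_class_in_base/(sub_finite_set _ fG).
  have := @len_reduced _ H K phi phi_iso 1 [:: (true, 1)] isT.
  by rewrite base1 /= base1 mul1g !mulg1 tx len_base.
move=> g _ g1 fC; have [x gx] := finite_class_in_base fC; subst g.
have x1 : x <> 1 by move=> xE; apply: g1; rewrite xE base1.
have [fD DHK xD Dphi] := finite_class_orbit x1 fC.
have [|z xz|y xy] := hyp x; first exact: sub_finite_set fD.
  exact/DHK/xD.
have DHK' : base @^-1` conj_class setT (base x) `<=` [set` H] `&` [set` K].
  by move=> z /DHK[].
have [j j0 jy] := finite_orbit_fixed fD DHK' Dphi (xD y xy).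
by move=> /(_ j j0).
Qed.

End FiniteClasses.

Theorem mainTheorem1 (Lambda : groupType) (H K : groupClosed Lambda)
    (phi : Lambda -> Lambda) :
  countable [set: Lambda] ->
  subgroup_iso H K phi ->
  [set` H] <> [set: Lambda] \/ [set` K] <> [set: Lambda] ->
  ((forall x : Lambda,
      finite_set (conj_class [set: Lambda] x) ->
      conj_class [set: Lambda] x `<=` ([set` H] `&` [set` K]) `\ 1 ->
      exists2 y : Lambda, conj_class [set: Lambda] x y &
        forall j : nat, (1 <= j)%N -> ~ iter_fixed_point H K phi j y) ->
   ICC [set: HNN H phi])
  /\
  (ICC [set: Lambda] \/ ICC [set` H] \/ ICC [set` K] \/
     ICC ([set` H] `&` [set` K]) \/
     (forall (j : nat) (x : Lambda),
        (1 <= j)%N -> iter_fixed_point H K phi j x -> x = 1) ->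
   ICC [set: HNN H phi]).
Proof.
move=> _ phi_iso proper; have main := ICC_of_classes phi_iso proper.
split=> // hyp; apply: main => x fx xHK.
have [[Hx Kx] x1] := xHK x (conj_classxx x).
have noICC (A : set Lambda) : ICC A -> ~ A x.
  move=> [_ icc] Ax; have := icc x Ax x1; apply; apply: sub_finite_set fx => _ [g _ <-].
  by exists g.
case: hyp => [/noICC[]|[/noICC[]|[/noICC[]|[/noICC[]|fixed]]]] //.
exists x; first exact: conj_classxx.
by move=> j j1 /(fixed j x j1).
Qed.
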